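(* Given a graph $G$, an integer $d>2$, and a vertex cover of $G$ of size $\mathrm{vc}$, there exists an algorithm solving the unweighted $d$-Scattered Set problem in time $O^*(3^{\mathrm{vc}})$ when $d$ is even and in time $O^*(4^{\mathrm{vc}})$ when $d$ is odd.
   Context: Unweighted $d$-Scattered Set: given a graph $G=(V,E)$ and integers $d,k$, decide whether there is $K\subseteq V$ with $|K|\ge k$ such that the (unweighted) shortest-path distance between every two distinct vertices of $K$ is at least $d$. A vertex cover is a set $C\subseteq V$ such that every edge has an endpoint in $C$. $O^*(\cdot)$ hides factors polynomial in the input size. *)

(* Defs.v *)
From mathcomp Require Import all_boot.

Set Implicit Arguments.
Unset Strict Implicit.
Unset Printing Implicit Defensive.

(** * Graphs

    A graph on [n] labelled vertices is a symmetric irreflexive relation on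
    ['I_n]. *)

Section Graph.
Variables (T : finType) (e : rel T).

Definition vertex_cover (C : {set T}) : Prop :=
  forall x y, e x y -> (x \in C) || (y \in C).

Definition walk (x y : T) (l : nat) : bool :=
  [exists p : l.-tuple T, path e x p && (last x p == y)].

Lemma connect_walk x y : connect e x y -> exists l, walk x y l.
Proof.
case/connectP=> p e_p ->; exists (size p); apply/existsP.
by exists (in_tuple p); rewrite e_p eqxx.
Qed.

(* [None] stands for the infinite distance between distinct components. *)
Definition dist (x y : T) : option nat :=
  if @idP (connect e x y) is ReflectT xy then Some (ex_minn (connect_walk xy))
  else None.

Definition at_least (d : nat) (l : option nat) : bool :=
  if l is Some m then d <= m else true.

Definition scattered (d : nat) (K : {set T}) : bool :=
  [forall x in K, forall y in K, (x != y) ==> at_least d (dist x y)].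

Definition has_scattered_set (d k : nat) : bool :=
  [exists K : {set T}, (k <= #|K|) && scattered d K].

End Graph.

(** * Algorithms and running time

    Algorithms are programs of a while-language over a random access memory,
    consisting of variables and of unbounded arrays of natural numbers. Time is
    measured by the logarithmic cost criterion: each elementary step is charged
    the bit length of the numbers it handles, addresses included. All the
    arithmetic primitives can be computed in quasi-linear time in the bit length
    of their operands, so that this agrees, up to factors polylogarithmic in the
    running time, with the logarithmic-cost RAM. *)

Definition bitlen (n : nat) : nat := (trunc_log 2 n).+1.

Inductive binop := Add | Sub | Mul | Div | Mod | Eq | Lt.

Inductive expr :=
  | Const of nat
  | Var of nat
  | Get of nat & expr            (* [Get a i] reads cell [i] of array [a] *)
  | Bin of binop & expr & expr.

Inductive cmd :=
  | Skip
  | Assign of nat & expr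
  | Put of nat & expr & expr     (* [Put a i v] writes [v] in cell [i] of [a] *)
  | Seq of cmd & cmd
  | If of expr & cmd & cmd
  | While of expr & cmd.

Record store := Store { var : nat -> nat; arr : nat -> nat -> nat }.

Definition upd (A : Type) (f : nat -> A) (i : nat) (v : A) : nat -> A :=
  fun j => if j == i then v else f j.

Definition set_var (s : store) (x v : nat) : store :=
  Store (upd (var s) x v) (arr s).

Definition set_arr (s : store) (a i v : nat) : store :=
  Store (var s) (upd (arr s) a (upd (arr s a) i v)).

Definition op_val (o : binop) (m n : nat) : nat :=
  match o with
  | Add => m + n
  | Sub => m - n
  | Mul => m * n
  | Div => m %/ n
  | Mod => m %% n
  | Eq => m == n
  | Lt => m < n
  end.

Fixpoint eval (s : store) (e : expr) : nat :=
  match e with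
  | Const n => n
  | Var x => var s x
  | Get a i => arr s a (eval s i)
  | Bin o e1 e2 => op_val o (eval s e1) (eval s e2)
  end.

(* [bitlen (eval s e) <= cost s e], hence operands and addresses, which are
   values of subexpressions, are charged for as well. *)
Fixpoint cost (s : store) (e : expr) : nat :=
  match e with
  | Const _ | Var _ => 0
  | Get _ i => cost s i
  | Bin _ e1 e2 => cost s e1 + cost s e2
  end + bitlen (eval s e).

(* [exec c s t s']: run from [s], the command [c] halts in [s'] in time [t].
   A condition holds when its value is nonzero. *)
Inductive exec : cmd -> store -> nat -> store -> Prop :=
  | exec_skip s : exec Skip s 1 s
  | exec_assign s x e :
      exec (Assign x e) s (cost s e).+1 (set_var s x (eval s e))
  | exec_put s a i e :
      exec (Put a i e) s (cost s i + cost s e).+1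
        (set_arr s a (eval s i) (eval s e))
  | exec_seq c1 c2 s1 t1 s2 t2 s3 :
      exec c1 s1 t1 s2 -> exec c2 s2 t2 s3 ->
      exec (Seq c1 c2) s1 (t1 + t2).+1 s3
  | exec_if e c1 c2 s t s' :
      exec (if eval s e != 0 then c1 else c2) s t s' ->
      exec (If e c1 c2) s (cost s e + t).+1 s'
  | exec_while_end e c s :
      eval s e = 0 -> exec (While e c) s (cost s e).+1 s
  | exec_while_step e c s1 t1 s2 t2 s3 :
      eval s1 e != 0 -> exec c s1 t1 s2 -> exec (While e c) s2 t2 s3 ->
      exec (While e c) s1 (cost s1 e + t1 + t2).+1 s3.

Lemma exec_det c s t1 s1 t2 s2 :
  exec c s t1 s1 -> exec c s t2 s2 -> t1 = t2 /\ s1 = s2.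
Proof.
move=> ex1; elim: ex1 t2 s2 => {c s t1 s1}.
- by move=> s t s' H; inversion H.
- by move=> s x e t s' H; inversion H.
- by move=> s a i e t s' H; inversion H.
- move=> c1 c2 s1 t1 s2 t2 s3 _ IH1 _ IH2 t s' H.
  inversion H as [| | |? ? ? ? ? ? ? ex1 ex2| | |]; subst.
  by case: (IH1 _ _ ex1) => ? ?; subst; case: (IH2 _ _ ex2) => -> ->.
- move=> e c1 c2 s t s' _ IH t' s'' H.
  inversion H as [| | | |? ? ? ? ? ? ex1| |]; subst.
  by case: (IH _ _ ex1) => -> ->.
- move=> e c s s0 t s' H.
  inversion H as [| | | | | |? ? ? ? ? ? ? nz]; subst=> //.
  by rewrite s0 in nz.
move=> e c s1 t1 s2 t2 s3 nz _ IH1 _ IH2 t s' H.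
inversion H as [| | | | |? ? ? z|? ? ? ? ? ? ? _ ex1 ex2]; subst.
  by rewrite z in nz.
by case: (IH1 _ _ ex1) => ? ?; subst; case: (IH2 _ _ ex2) => -> ->.
Qed.

(** * Instances

    Variables 0, 1, 2 hold [n], [d] and [k]; array 0 holds the adjacency matrix,
    row by row, and array 1 the characteristic vector of the vertex cover. All
    the rest of the memory is initially zero. *)

Definition input (n : nat) (e : rel 'I_n) (d k : nat) (C : {set 'I_n}) : store :=
  Store
    (fun x => match x with 0 => n | 1 => d | 2 => k | _ => 0 end)
    (fun a p => match a with
                | 0 => [exists i : 'I_n, exists j : 'I_n, (p == i * n + j) && e i j]
                | 1 => [exists i : 'I_n, (p == i) && (i \in C)]
                | _ => 0
                end).

(* Number of bits of the input; the numbers [d] and [k] are in binary. *)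
Definition input_size (n d k : nat) : nat :=
  n * n + n + bitlen n + bitlen d + bitlen k.

(* The answer is returned in variable 0: 1 for yes, 0 for no. *)
Definition output (s : store) : nat := var s 0.

(* Main.v *)
Require Import Defs.
From mathcomp Require Import all_boot zify.

(** Let q be 3 for even d and 4 for odd d, let H = d/2 + q - 2 (rounded down),
    and give a vertex u the level L u c = min (q - 1) (H - dist u c), truncated
    at 0, at each vertex c of the cover. Two distinct vertices u and v are at
    distance less than d if and only if L u c + L v c >= q for some c in the
    cover: on a shortest path between u and v, some end of a middle edge is in
    the cover. Hence scattered sets are exactly the packings of the vectors L u,
    where the levels of any two vectors at the same c must add up to less than
    q. What a choice of vertices forbids is determined by the pointwise maximum
    of their vectors, one of q ^ vc states. A largest packing is found by dynamic
    programming over the vertices and the states. *)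

Set Implicit Arguments.
Unset Strict Implicit.
Unset Printing Implicit Defensive.

(** * Cost of programs *)

(** Size of values in units of [W] bits, uniform over all stores bounded by [2 ^ W]. Sizes add at
    every operator, which is what a product requires. *)
Fixpoint esize (e : expr) : nat :=
  match e with
  | Const n => bitlen n
  | Var _ => 1
  | Get _ i => 1
  | Bin _ e1 e2 => esize e1 + esize e2
  end.

Fixpoint ecost (e : expr) : nat :=
  match e with
  | Const _ | Var _ => 0
  | Get _ i => ecost i
  | Bin _ e1 e2 => ecost e1 + ecost e2
  end + esize e.

Fixpoint ccost (c : cmd) : nat :=
  match c with
  | Skip => 0
  | Assign _ e => ecost e
  | Put _ i e => ecost i + ecost e
  | Seq c1 c2 => ccost c1 + ccost c2
  | If e c1 c2 => ecost e + ccost c1 + ccost c2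
  | While e c => ecost e + ccost c
  end.+1.

Definition bounded (W : nat) (s : store) : Prop :=
  (forall x, var s x < 2 ^ W) /\ (forall a i, arr s a i < 2 ^ W).

Lemma bitlen_leq m l : 0 < l -> m < 2 ^ l -> bitlen m <= l.
Proof.
move=> l_gt0 lt_m; rewrite /bitlen; case: (posnP m) => [->|m_gt0].
  by rewrite trunc_log0.
by rewrite -(ltn_exp2l _ _ (ltnSn 1)) (leq_ltn_trans (trunc_logP _ _)).
Qed.

Lemma ltn_bitlen m : m < 2 ^ bitlen m.
Proof. exact: trunc_log_ltn. Qed.

Lemma esize_gt0 e : 0 < esize e.
Proof. by elim: e => //= o e1 IH1 e2 IH2; rewrite ltn_addr. Qed.

Lemma op_val_lt o m1 m2 l1 l2 : 0 < l1 -> 0 < l2 ->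
  m1 < 2 ^ l1 -> m2 < 2 ^ l2 -> op_val o m1 m2 < 2 ^ (l1 + l2).
Proof.
move=> l10 l20 lt1 lt2; rewrite expnD.
have le1 : 2 <= 2 ^ l1 by rewrite -{1}[2]expn1 leq_exp2l.
have le2 : 2 <= 2 ^ l2 by rewrite -{1}[2]expn1 leq_exp2l.
have lt1' : m1 < 2 ^ l1 * 2 ^ l2 by nia.
by case: o => /=; nia.
Qed.

Section Cost.
Variables (W : nat) (s : store).
Hypotheses (W_gt0 : 0 < W) (s_bounded : bounded W s).

Lemma eval_lt e : eval s e < 2 ^ (W * esize e).
Proof.
elim: e => [m|x|a i _|o e1 IH1 e2 IH2] /=.
- apply: leq_trans (ltn_bitlen m) _; rewrite leq_exp2l //; exact: leq_pmull.
- by rewrite muln1; case: s_bounded.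
- by rewrite muln1; case: s_bounded.
- by rewrite mulnDr op_val_lt // muln_gt0 W_gt0 esize_gt0.
Qed.

Lemma cost_leq e : cost s e <= W * ecost e.
Proof.
have bl e' : bitlen (eval s e') <= W * esize e'.
  by rewrite bitlen_leq ?eval_lt // muln_gt0 W_gt0 esize_gt0.
elim: e => [m|x|a i IH|o e1 IH1 e2 IH2] /=; rewrite mulnDr leq_add //;
  try exact: (bl (Const _)); try exact: (bl (Var _));
  try exact: (bl (Get _ _)); try exact: (bl (Bin _ _ _)).
by rewrite mulnDr leq_add.
Qed.

End Cost.

Lemma bounded_set_var W s x v :
  bounded W s -> v < 2 ^ W -> bounded W (set_var s x v).
Proof.
by case=> bv ba vW; split=> //= y; rewrite /upd; case: ifP.
Qed.

Lemma bounded_set_arr W s a i v :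
  bounded W s -> v < 2 ^ W -> bounded W (set_arr s a i v).
Proof.
case=> bv ba vW; split=> //= b j; rewrite /upd; case: ifP => // _.
by case: ifP.
Qed.

(* [steps W c s t s']: [c] runs from [s] to [s'] in [t] elementary steps, every
   assigned value being smaller than [2 ^ W]. *)
Inductive steps (W : nat) : cmd -> store -> nat -> store -> Prop :=
  | steps_assign s x e :
      eval s e < 2 ^ W -> steps W (Assign x e) s 1 (set_var s x (eval s e))
  | steps_put s a i e :
      eval s e < 2 ^ W ->
      steps W (Put a i e) s 1 (set_arr s a (eval s i) (eval s e))
  | steps_seq c1 c2 s1 t1 s2 t2 s3 :
      steps W c1 s1 t1 s2 -> steps W c2 s2 t2 s3 ->
      steps W (Seq c1 c2) s1 (t1 + t2).+1 s3
  | steps_while_end e c s :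
      eval s e = 0 -> steps W (While e c) s 1 s
  | steps_while_step e c s1 t1 s2 t2 s3 :
      eval s1 e != 0 -> steps W c s1 t1 s2 -> steps W (While e c) s2 t2 s3 ->
      steps W (While e c) s1 (t1 + t2).+1 s3.

(** Separates step counting from logarithmic cost: the store stays bounded, so each elementary step
    costs at most [W] times a constant of the program text. *)
Lemma exec_of_steps W c s t s' : 0 < W -> bounded W s -> steps W c s t s' ->
  bounded W s' /\ exists2 t', exec c s t' s' & t' <= t * (W * ccost c).
Proof.
move=> W0 bs st; elim: st bs => {c s t s'}.
- move=> s x e lt bs; split; first exact: bounded_set_var.
  exists (cost s e).+1; first exact: exec_assign.
  by have := cost_leq W0 bs e; rewrite /=; nia.
- move=> s a i e lt bs; split; first exact: bounded_set_arr.
  exists (cost s i + cost s e).+1; first exact: exec_put.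
  by have := cost_leq W0 bs e; have := cost_leq W0 bs i; rewrite /=; nia.
- move=> c1 c2 s1 t1 s2 t2 s3 _ IH1 _ IH2 /IH1[/IH2[bs3 [u2 ex2 le2]]].
  move=> [u1 ex1 le1]; split=> //; exists (u1 + u2).+1.
    exact: exec_seq ex1 ex2.
  rewrite /=; nia.
- move=> e c s s0 bs; split=> //; exists (cost s e).+1.
    exact: exec_while_end.
  by have := cost_leq W0 bs e; rewrite /=; nia.
- move=> e c s1 t1 s2 t2 s3 nz _ IH1 _ IH2 bs.
  have [/IH2[bs3 [u2 ex2 le2]] [u1 ex1 le1]] := IH1 bs.
  split=> //; exists (cost s1 e + u1 + u2).+1.
    exact: exec_while_step nz ex1 ex2.
  by have := cost_leq W0 bs e; rewrite /= in le2 *; nia.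
Qed.

(** * Rules for total correctness with a bound on the number of steps *)

Definition runs (W : nat) (c : cmd) (s : store) (t : nat) (Q : store -> Prop) :=
  exists t' s', [/\ steps W c s t' s', t' <= t & Q s'].

Lemma runs_weaken W c s t1 t2 (Q1 Q2 : store -> Prop) :
  runs W c s t1 Q1 -> t1 <= t2 -> (forall s', Q1 s' -> Q2 s') ->
  runs W c s t2 Q2.
Proof.
move=> [t [s' [st le Qs]]] le12 Q12; exists t, s'; split=> //; last exact: Q12.
exact: leq_trans le12.
Qed.

Lemma runs_assign W x e s (Q : store -> Prop) :
  eval s e < 2 ^ W -> Q (set_var s x (eval s e)) -> runs W (Assign x e) s 1 Q.
Proof. by move=> lt Qs; eexists _, _; split; [exact: steps_assign| |]. Qed.

Lemma runs_put W a i e s (Q : store -> Prop) :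
  eval s e < 2 ^ W -> Q (set_arr s a (eval s i) (eval s e)) ->
  runs W (Put a i e) s 1 Q.
Proof. by move=> lt Qs; eexists _, _; split; [exact: steps_put| |]. Qed.

Lemma runs_seq W c1 c2 s t1 t2 t (Q1 Q : store -> Prop) :
  runs W c1 s t1 Q1 -> (forall s', Q1 s' -> runs W c2 s' t2 Q) ->
  t1 + t2 < t -> runs W (Seq c1 c2) s t Q.
Proof.
move=> [u1 [s1 [st1 le1 Q1s]]] r2 lt; have [u2 [s2 [st2 le2 Qs]]] := r2 _ Q1s.
by exists (u1 + u2).+1, s2; split; [exact: steps_seq st1 st2|lia|].
Qed.

Lemma runs_assign_seq W x e c s t (Q : store -> Prop) :
  eval s e < 2 ^ W -> runs W c (set_var s x (eval s e)) t Q ->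
  runs W (Seq (Assign x e) c) s t.+2 Q.
Proof.
move=> lt r; apply: (runs_seq (Q1 := eq _)); first exact: runs_assign erefl.
  by move=> s' <-; exact: r.
by [].
Qed.

Lemma runs_put_seq W a i e c s t (Q : store -> Prop) :
  eval s e < 2 ^ W -> runs W c (set_arr s a (eval s i) (eval s e)) t Q ->
  runs W (Seq (Put a i e) c) s t.+2 Q.
Proof.
move=> lt r; apply: (runs_seq (Q1 := eq _)); first exact: runs_put erefl.
  by move=> s' <-; exact: r.
by [].
Qed.

(** The invariant carries a counter [j] that decides the test, so a [While] behaves as a for loop.
    It may be entered at any [i <= m], since the table loops start after the first layer. *)
Lemma runs_while W e c t m (I : nat -> store -> Prop) i s :
  (forall j s, I j s -> eval s e = (j < m)) ->
  (forall j s, j < m -> I j s -> runs W c s t (I j.+1)) ->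
  i <= m -> I i s -> runs W (While e c) s ((m - i) * t.+1).+1 (I m).
Proof.
move=> cond body; have [r] := ubnP (m - i).
elim: r i s => // r IH i s ltr; rewrite leq_eqVlt => /orP[/eqP->|ltim] Is.
  exists 1, s; split=> //.
  by apply: steps_while_end; rewrite (cond _ _ Is) ltnn.
have [t1 [s1 [st1 le1 Is1]]] := body _ _ ltim Is.
have [|t2 [s2 [st2 le2 Is2]]] := IH i.+1 s1 _ ltim Is1; first by lia.
exists (t1 + t2).+1, s2; split=> //; last by nia.
by apply: steps_while_step st1 st2; rewrite (cond _ _ Is) ltim.
Qed.

(** * Walks *)

Section Walks.
Variables (T : finType) (e : rel T).

Lemma walkP x y l :
  reflect (exists p, [/\ path e x p, last x p = y & size p = l]) (walk e x y l).
Proof.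
apply: (iffP existsP) => [[p /andP[ep /eqP lp]]|[p [ep lp sp]]].
  by exists p; rewrite size_tuple.
by move/eqP: sp => sp; exists (Tuple sp); rewrite /= ep lp eqxx.
Qed.

Lemma walk0 x y : walk e x y 0 = (x == y).
Proof.
apply/walkP/eqP => [[p [_ lp /size0nil p0]]|->]; first by rewrite -lp p0.
by exists [::].
Qed.

Lemma walkSP x y l :
  reflect (exists2 z, e x z & walk e z y l) (walk e x y l.+1).
Proof.
apply: (iffP (walkP _ _ _)) => [[[|z p] [] //= /andP[xz zp] lp [sp]]|].
  by exists z => //; apply/walkP; exists p.
case=> z xz /walkP[p [zp lp sp]].
by exists (z :: p); rewrite /= xz zp sp.
Qed.

Lemma walk_trans x y z l1 l2 :
  walk e x y l1 -> walk e y z l2 -> walk e x z (l1 + l2).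
Proof.
move=> /walkP[p [xp lp sp]] /walkP[r [yr lr sr]]; apply/walkP; exists (p ++ r).
by rewrite cat_path xp last_cat size_cat lp yr lr sp sr.
Qed.

Lemma walk_sym x y l : symmetric e -> walk e x y l -> walk e y x l.
Proof.
move=> e_sym /walkP[p [xp lp sp]]; apply/walkP; exists (rev (belast x p)).
rewrite size_rev size_belast sp -lp rev_path; split=> //.
  by rewrite (eq_path (e' := e)) // => u v; rewrite e_sym.
by case: p {xp lp sp} => //= y' p; rewrite rev_cons last_rcons.
Qed.

(** Distances are handled through walks from here on; infinite distance is the case without any
    walk. *)
Lemma at_leastP d x y :
  reflect (forall l, walk e x y l -> d <= l) (at_least d (dist e x y)).
Proof.
(* [dist] matches on the proof [idP] itself, so the claim is generalized to any reflection proof. *)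
suff dP b (r : reflect (connect e x y) b) :
  reflect (forall l, walk e x y l -> d <= l)
    (at_least d (if r is ReflectT xy then Some (ex_minn (connect_walk xy))
                 else None)) by exact: (dP _ idP).
case: r => [xy|nxy] /=.
  case: ex_minnP => m xym minm; apply: (iffP idP) => [dm l /minm|]; last exact.
  exact: leq_trans.
apply: ReflectT => l /walkP[p [xp lp _]]; case: nxy.
by apply/connectP; exists p.
Qed.

(** Removing loops leaves distinct vertices. The bound [#|T|] ensures that the table [near n] sees
    the walks that matter. *)
Lemma walk_shorten x y l : walk e x y l ->
  exists p, [/\ path e x p, last x p = y, size p <= l & size p < #|T|].
Proof.
case/walkP=> p [xp lp sp]; case: (shortenP xp) lp => p' xp' up' sp' lp.
exists p'; split=> //; last first.
  by have := max_card (mem (x :: p')); rewrite (card_uniqP up').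
by rewrite -sp uniq_leq_size //; case/andP: up'.
Qed.

Lemma path_split x p i : path e x p -> i <= size p ->
  walk e x (nth x (x :: p) i) i /\
  walk e (nth x (x :: p) i) (last x p) (size p - i).
Proof.
elim: i x p => [|i IH] x p xp le_i.
  by rewrite subn0 walk0 eqxx; split=> //; apply/walkP; exists p.
case: p xp le_i => // z p /= /andP[xz zp] le_i.
have [w1 w2] := IH z p zp le_i.
have -> : nth x (z :: p) i = nth z (z :: p) i by apply: set_nth_default.
by rewrite subSS; split=> //; apply/walkSP; exists z.
Qed.

End Walks.

(** * The two tables *)

Section Tables.
Variables (n : nat) (adj cov : nat -> nat) (q H : nat).

(* [near t u c] is the truncated difference [H - l], where [l] is the length of
   a shortest walk of length less than [t] from [u] to [c], and [0] if there is
   no such walk: see [nearP]. *)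
Fixpoint near (t u c : nat) : nat :=
  if t is t'.+1 then
    maxn (H * (u == c)) (\max_(v < n) (adj (u * n + v) * (near t' v c - 1)))
  else 0.

Definition level (u c : nat) : nat := cov c * minn (q - 1) (near n u c).

(* A state assigns a level to each vertex of the cover. It is encoded in mixed
   radix, with one digit in base [q] for each vertex of the cover, and a dummy
   digit in base 1 for each of the other vertices. *)
Definition radix (c : nat) : nat := 1 + (q - 1) * cov c.
Definition weight (c : nat) : nat := \prod_(j < c) radix j.
Definition digit (s c : nat) : nat := s %/ weight c %% radix c.

Definition join (u s : nat) : nat :=
  \sum_(j < n) weight j * maxn (digit s j) (level u j).

Definition fits (u s : nat) : bool :=
  [forall c : 'I_n, digit s c + level u c < q].

(* [packing i s] is the largest size of a scattered set of vertices below [i]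
   whose levels are compatible with those of the state [s]. *)
Fixpoint packing (i s : nat) : nat :=
  if i is u.+1 then
    maxn (packing u s) (fits u s * (packing u (join u s)).+1)
  else 0.

(** * Mixed radix numbers and bounds on the table entries *)

Lemma weightS c : weight c.+1 = weight c * radix c.
Proof. by rewrite /weight big_ord_recr. Qed.

Lemma weight_gt0 c : 0 < weight c.
Proof. by rewrite prodn_gt0. Qed.

Lemma weight_dvd c m : c <= m -> weight c %| weight m.
Proof.
by move/subnK <-; elim: (m - c) => //= r IH; rewrite weightS dvdn_mulr.
Qed.

Lemma encode_lt (f : nat -> nat) m : (forall j, j < m -> f j < radix j) ->
  \sum_(j < m) weight j * f j < weight m.
Proof.
elim: m => [|m IH] lt_f; first by rewrite big_ord0 weight_gt0.
rewrite big_ord_recr weightS /=.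
have lt1 : \sum_(j < m) weight j * f j < weight m.
  by apply: IH => j jm; apply: lt_f; rewrite ltnW.
apply: (@leq_trans (weight m * (f m).+1)); last by rewrite leq_mul2l lt_f ?orbT.
by rewrite mulnS -addSn leq_add2r.
Qed.

(** Lower digits sum to less than [weight c] and vanish in the division; higher ones contribute
    multiples of [weight c * radix c] and vanish in the remainder. *)
Lemma digit_encode (f : nat -> nat) m c : (forall j, j < m -> f j < radix j) ->
  c < m -> digit (\sum_(j < m) weight j * f j) c = f c.
Proof.
elim: m => // m IH lt_f; rewrite big_ord_recr /= ltnS leq_eqVlt.
have lt_f' j : j < m -> f j < radix j by move=> jm; apply: lt_f; rewrite ltnW.
have fm := lt_f m (ltnSn m).
case/orP => [/eqP->|cm]; rewrite /digit.
  rewrite addnC mulnC divnMDl ?weight_gt0 // (divn_small (encode_lt lt_f')).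
  by rewrite addn0 modn_small.
rewrite -(IH lt_f' cm) /digit; have /dvdnP[r ->] := weight_dvd cm.
rewrite weightS (_ : r * _ * f m = r * f m * radix c * weight c); last by lia.
by rewrite addnC divnMDl ?weight_gt0 // modnMDl.
Qed.

Lemma near_leq t u c : (forall p, adj p <= 1) -> near t u c <= H.
Proof.
move=> adj1; elim: t u => //= t IH u; rewrite geq_max; apply/andP; split.
  by case: eqP; rewrite ?muln1 ?muln0.
apply/bigmax_leqP => v _; apply: (@leq_trans (1 * H)); last by rewrite mul1n.
by rewrite leq_mul // (leq_trans (leq_subr _ _)).
Qed.

Lemma packing_leq i s : packing i s <= i.
Proof.
elim: i s => //= i IH s; rewrite geq_max (leq_trans (IH s)) //=.
by case: fits; rewrite ?mul1n ?mul0n // ltnS.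
Qed.

Lemma digit_lt s c : digit s c < radix c.
Proof. by rewrite ltn_mod. Qed.

Section Join.
Hypothesis cov1 : forall c, cov c <= 1.

Lemma level_lt u c : level u c < radix c.
Proof. by rewrite /level /radix; have := cov1 c; nia. Qed.

Lemma join_lt u s : join u s < weight n.
Proof.
apply: (encode_lt (f := fun j => maxn _ _)) => j _.
by rewrite gtn_max digit_lt level_lt.
Qed.

Lemma digit_join u s c : c < n ->
  digit (join u s) c = maxn (digit s c) (level u c).
Proof.
move=> cn; pose f j := maxn (digit s j) (level u j).
rewrite -[RHS]/(f c); apply: digit_encode => // j _.
by rewrite gtn_max digit_lt level_lt.
Qed.

End Join.

End Tables.

(** * Scattered sets as packings *)

Section ScatteredPacking.
Variables (n : nat) (e : rel 'I_n) (C : {set 'I_n}) (d : nat).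
Hypotheses (e_sym : symmetric e) (d_gt2 : 2 < d) (C_cover : vertex_cover e C).
Variables adj cov : nat -> nat.
Hypothesis adjE : forall u v : 'I_n, adj (u * n + v) = e u v.
Hypothesis covE : forall c : 'I_n, cov c = (c \in C).
Hypothesis cov1 : forall c, cov c <= 1.

(** For both parities [2 * H - q = d - 1], so the untruncated levels [H - a] and [H - b] add up to
    at least [q] exactly when [a + b < d]. *)
Let q := 3 + d %% 2.
Let H := d %/ 2 + (q - 2).
Local Notation near' := (near n adj H).
Local Notation level' := (level n adj cov q H).
Local Notation digit' := (digit cov q).
Local Notation fits' := (fits n adj cov q H).
Local Notation join' := (join n adj cov q H).
Local Notation packing' := (packing n adj cov q H).

(** Testing against every threshold [j] avoids naming a shortest walk and treats a missing walk like
    one of length at least [H]. Crossing the first edge raises the threshold by one. *)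
Lemma nearP t (u c : 'I_n) j :
  reflect (exists l, [/\ l < t, walk e u c l & l + j < H]) (j < near' t u c).
Proof.
apply: (iffP idP).
  elim: t u j => //= t IH u j; rewrite leq_max => /orP[].
    case: (altP (u =P c :> nat)) => [/ord_inj -> |]; last by rewrite muln0.
    by rewrite muln1 => jH; exists 0; rewrite walk0 eqxx.
  (* A maximum is attained only over a nonempty range; the vertex [u] gives [n > 0]. *)
  case: (posnP n) => [n0|n_gt0]; first by have := ltn_ord u; rewrite {2}n0.
  pose f (v : 'I_n) := adj (u * n + v) * (near' t v c - 1).
  have [|v /= ->] := eq_bigmax f; rewrite /f.
    by rewrite card_ord.
  rewrite adjE; case: (boolP (e u v)) => uv; rewrite ?mul0n // mul1n => jv.
  have /IH[l [lt vc ljH]] : j.+1 < near' t v c by lia.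
  by exists l.+1; split; [lia|apply/walkSP; exists v|lia].
case=> l [lt uc ljH]; elim: t u j l lt uc ljH => //= t IH u j [|l] lt uc ljH.
  by move: uc; rewrite walk0 => /eqP->; rewrite eqxx muln1 leq_max ljH.
case/walkSP: uc => v uv vc.
have near_v : j.+1 < near' t v c by apply: (IH _ _ l) => //; lia.
rewrite leq_max; apply/orP; right.
apply: leq_trans (leq_bigmax v); rewrite adjE uv mul1n; lia.
Qed.

Lemma level_cover (u c : 'I_n) :
  level' u c = (c \in C) * minn (q - 1) (near' n u c).
Proof. by rewrite /level covE. Qed.

Lemma walk_near (u c : 'I_n) l : walk e u c l -> l < n -> H - l <= near' n u c.
Proof.
move=> uc l_n; case: (posnP (H - l)) => [->//|Hl].
rewrite -(prednK Hl); apply/nearP; exists l; split=> //; lia.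
Qed.

(** On a path with [d - 1] edges, an end of the middle edge gets levels 2 and 1 if [d] is even, and
    3 and 1 or 2 and 2 if [d] is odd: the sum is [q] despite the cap [q - 1]. Shorter paths do not
    lower these levels. *)
Lemma close_conflict (u v : 'I_n) l : u != v -> walk e u v l -> l < d ->
  exists c : 'I_n, q <= level' u c + level' v c.
Proof.
move=> neq_uv /walk_shorten[p [up lp sp]]; rewrite card_ord => p_n l_d.
have p0 : 0 < size p.
  by case: p lp neq_uv {up sp p_n} => //= ->; rewrite eqxx.
(* This reduces the claim to arithmetic on the position [i] of a cover vertex along the path. *)
have good i : i <= size p -> nth u (u :: p) i \in C ->
    q <= minn (q - 1) (H - i) + minn (q - 1) (H - (size p - i)) ->
    exists c : 'I_n, q <= level' u c + level' v c.
  move=> i_p iC le_q; exists (nth u (u :: p) i); rewrite !level_cover iC !mul1n.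
  have [w1 w2] := path_split up i_p; rewrite lp in w2.
  have near_u := walk_near w1 (leq_ltn_trans i_p p_n).
  have near_v :=
    walk_near (walk_sym e_sym w2) (leq_ltn_trans (leq_subr _ _) p_n).
  apply: leq_trans le_q _; rewrite leq_add // leq_min geq_minl /=;
    exact: leq_trans (geq_minr _ _) _.
(* Both ends of a middle edge of the path witness the conflict, and one of them
   is in the cover. *)
have half : (size p).-1 %/ 2 < size p by lia.
have edge := pathP u up _ half.
have half_d : (size p).-1 %/ 2 <= d %/ 2 - 1 by lia.
case/orP: (C_cover edge) => xC.
  by apply: good xC _; rewrite /H /q; lia.
by apply: (good (((size p).-1 %/ 2).+1) _ xC); rewrite /H /q; lia.
Qed.

(** Levels are at most [q - 1], so a sum of [q] makes both positive. Both then come from actual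
    walks, of total length at most [2 * H - q = d - 1]. *)
Lemma conflict_close (u v c : 'I_n) : q <= level' u c + level' v c ->
  exists2 l, walk e u v l & l < d.
Proof.
rewrite !level_cover; case: (c \in C); rewrite ?mul0n // !mul1n => le_q.
have /nearP[l1 [_ w1 le1]] : minn (q - 1) (near' n u c) - 1 < near' n u c by lia.
have /nearP[l2 [_ w2 le2]] : minn (q - 1) (near' n v c) - 1 < near' n v c by lia.
exists (l1 + l2); first exact: walk_trans w1 (walk_sym e_sym w2).
by move: le1 le2 le_q; rewrite /H /q; lia.
Qed.

Definition compat (u v : 'I_n) : bool :=
  [forall c : 'I_n, level' u c + level' v c < q].

Lemma compatC u v : compat u v = compat v u.
Proof. by apply: eq_forallb => c; rewrite addnC. Qed.

Lemma at_least_compat u v : u != v -> at_least d (dist e u v) = compat u v.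
Proof.
move=> neq_uv; apply/at_leastP/forallP => [far c|uv l w].
  rewrite ltnNge; apply/negP => /conflict_close[l w].
  by rewrite ltnNge far.
rewrite leqNgt; apply/negP => /(close_conflict neq_uv w)[c].
by rewrite leqNgt uv.
Qed.

Definition packs (i s : nat) (K : {set 'I_n}) : bool :=
  [&& [forall u in K, u < i], scattered e d K & [forall u in K, fits' u s]].

Lemma scatteredP (K : {set 'I_n}) :
  reflect {in K &, forall u v, u != v -> compat u v} (scattered e d K).
Proof.
apply: (iffP forall_inP) => [sK u v uK vK neq_uv|sK u uK].
  have /forall_inP/(_ v vK)/implyP/(_ neq_uv) := sK u uK.
  by rewrite at_least_compat.
apply/forall_inP => v vK; apply/implyP => neq_uv.
by rewrite at_least_compat // sK.
Qed.

(** A level added to a maximum stays below [q] if and only if it does so with both arguments. Thus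
    the state loses nothing about the vertices already chosen. *)
Lemma fits_join (u v : 'I_n) s : fits' v (join' u s) = fits' v s && compat u v.
Proof.
rewrite /fits; apply/forallP/andP => [fit|[/forallP fit /forallP uv] c].
  by split; apply/forallP => c; move: (fit c); rewrite digit_join //; lia.
have := fit c; have := uv c; rewrite digit_join //; lia.
Qed.

Lemma packs0 i s : packs i s set0.
Proof.
apply/and3P; split; first by apply/forall_inP => u; rewrite inE.
  by apply/scatteredP => u v; rewrite inE.
by apply/forall_inP => u; rewrite inE.
Qed.

(** Either the set for the preceding vertices is reused, or the last vertex [u] is added to the set
    for [join' u s], whose members are compatible with [u] by [fits_join]. *)
Lemma packs_packing i s : i <= n ->
  exists2 K : {set 'I_n}, packs i s K & #|K| = packing' i s.
Proof.
elim: i s => [|i IH] s i_n.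
  by exists set0; rewrite ?cards0 // packs0.
pose u := Ordinal i_n.
have [K /and3P[/forall_inP ltK scK fitK] cK] := IH s (ltnW i_n).
have [K' /and3P[/forall_inP ltK' /scatteredP scK' /forall_inP fitK'] cK'] :=
  IH (join' u s) (ltnW i_n).
rewrite /=; case: leqP => _; last first.
  exists K => //; apply/and3P; split=> //.
  by apply/forall_inP => v /ltK /ltnW.
(* If [u] does not fit, the selected argument of the maximum is 0. *)
case: (boolP (fits _ _ _ _ _ _ _)) => fit_u; last first.
  by exists set0; rewrite ?cards0 // packs0.
have uK' : u \notin K' by apply/negP => /ltK'; rewrite ltnn.
have compat_u v : v \in K' -> compat u v.
  by move=> /fitK'; rewrite fits_join => /andP[].
exists (u |: K'); last by rewrite cardsU1 uK' cK' mul1n.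
apply/and3P; split.
- by apply/forall_inP => v; rewrite !inE => /orP[/eqP->//|/ltK'/ltnW].
- apply/scatteredP => v w; rewrite !inE.
  case/orP => [/eqP->|vK]; case/orP => [/eqP->|wK]; first by rewrite eqxx.
  + by rewrite compat_u.
  + by rewrite compatC compat_u.
  + exact: scK'.
- apply/forall_inP => v; rewrite !inE => /orP[/eqP->//|/fitK'].
  by rewrite fits_join => /andP[].
Qed.

(** If the last vertex [u] is in [K], the rest of [K] obeys the state [join' u s], being pairwise
    compatible with [u]; otherwise [K] is already counted one row earlier. *)
Lemma packing_max i s K : i <= n -> packs i s K -> #|K| <= packing' i s.
Proof.
elim: i s K => [|i IH] s K i_n /and3P[/forall_inP ltK scK /forall_inP fitK].
  suff -> : K = set0 by rewrite cards0.
  by apply/setP => u; rewrite inE; apply/negP => /ltK.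
pose u := Ordinal i_n; rewrite /= leq_max.
have ltK' v : v \in K -> v != u -> v < i.
  move=> /ltK; rewrite ltnS leq_eqVlt => /orP[/eqP vi|//] /eqP[].
  exact: val_inj.
case: (boolP (u \in K)) => uK; last first.
  apply/orP; left; apply: IH; first exact: ltnW.
  apply/and3P; split=> //; apply/forall_inP => v vK; last exact: fitK.
  by apply: ltK' => //; apply: contraNneq uK => <-.
apply/orP; right.
have -> : fits n adj cov q H i s by exact: (fitK u).
rewrite mul1n (cardsD1 u) uK ltnS; apply: (IH (join' u s)); first exact: ltnW.
move/scatteredP: scK => scK; apply/and3P; split.
- by apply/forall_inP => v; rewrite !inE => /andP[nu vK]; apply: ltK'.
- by apply/scatteredP => v w; rewrite !inE => /andP[_ vK] /andP[_ wK]; apply: scK.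
- apply/forall_inP => v; rewrite !inE => /andP[nu vK].
  by rewrite fits_join fitK // scK // eq_sym.
Qed.

Lemma has_scattered_set_packing k :
  has_scattered_set e d k = (k <= packing' n 0).
Proof.
(* State 0 forbids nothing: its digits are zero, and each level is below its radix, which is at most
   [q]. *)
have fit0 (u : 'I_n) : fits' u 0.
  apply/forallP => c; rewrite /digit div0n mod0n add0n.
  apply: (@leq_trans (radix cov q c)); first exact: level_lt.
  by rewrite /radix /q; case: (cov c) (cov1 c) => [|[|]] // _; lia.
apply/existsP/idP => [[K /andP[kK scK]]|kn].
  apply: leq_trans kK _; apply: packing_max => //; apply/and3P; split=> //.
    by apply/forall_inP => u _; apply: ltn_ord.
  by apply/forall_inP => u _; apply: fit0.
have [K /and3P[_ scK _] cK] := packs_packing 0 (leqnn n).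
by exists K; rewrite cK kn.
Qed.

End ScatteredPacking.

(** * The program *)

Section Program.

Declare Scope program_scope.
Delimit Scope program_scope with prog.
Bind Scope program_scope with expr.
Bind Scope program_scope with cmd.
Local Coercion Const : nat >-> expr.
Local Notation "$ x" := (Var x)
  (at level 1, x at level 1, format "$ x") : program_scope.
Local Notation "a [ i ]" := (Get a i)
  (at level 2, left associativity, i at level 200) : program_scope.
Local Notation "x + y" := (Bin Add x y) : program_scope.
Local Notation "x - y" := (Bin Defs.Sub x y) : program_scope.
Local Notation "x * y" := (Bin Mul x y) : program_scope.
Local Notation "x / y" := (Bin Div x y)
  (at level 40, left associativity) : program_scope.
Local Notation "x % y" := (Bin Mod x y)
  (at level 40, left associativity) : program_scope.
Local Notation "x =? y" := (Bin Eq x y)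
  (at level 70, no associativity) : program_scope.
Local Notation "x <? y" := (Bin Lt x y)
  (at level 70, no associativity) : program_scope.
Local Notation "x <- e" := (Assign x e)
  (at level 90, e at level 80) : program_scope.
Local Notation "c1 ;; c2" := (Seq c1 c2)
  (at level 100, c2 at level 200, right associativity) : program_scope.

(** Truncated subtraction gives maxima and minima as expressions, so the program branches only at
    its loops. *)
Definition emax (x y : expr) : expr := (x + (y - x))%prog.
Definition emin (x y : expr) : expr := (x - (x - y))%prog.

Lemma eval_emax s x y : eval s (emax x y) = maxn (eval s x) (eval s y).
Proof. by rewrite maxnE. Qed.

(* [rp] is the address of the table entry being computed. While the digits of
   its state are scanned by [rv], [rx] holds the digits not yet read, [rw] the
   weight of the current digit, [rj] the digits of the join computed so far, and
   [rok] whether no conflict was found. *)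
Local Notation rn := 0 (only parsing).
Local Notation rd := 1 (only parsing).
Local Notation rk := 2 (only parsing).
Local Notation rq := 3 (only parsing).
Local Notation rH := 4 (only parsing).
Local Notation rp := 5 (only parsing).
Local Notation rv := 6 (only parsing).
Local Notation racc := 7 (only parsing).
Local Notation rQ := 8 (only parsing).
Local Notation rx := 9 (only parsing).
Local Notation rw := 10 (only parsing).
Local Notation rj := 11 (only parsing).
Local Notation rok := 12 (only parsing).
Local Notation rl := 13 (only parsing).
Local Notation rb := 14 (only parsing).
Local Notation adjacency := 0 (only parsing).
Local Notation cover := 1 (only parsing).
Local Notation nears := 2 (only parsing).
Local Notation packings := 3 (only parsing).

(** The entry for [t], [u], [c] is at address [t * (n * n) + u * n + c]; divisions and remainders of
    [rp] recover the three indices. *)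
Definition near_step : cmd := (
  racc <- emax $racc (adjacency[$rp / $rn % $rn * $rn + $rv] *
    (nears[($rp / ($rn * $rn) - 1) * ($rn * $rn) + $rv * $rn + $rp % $rn] - 1)) ;;
  rv <- $rv + 1)%prog.

Definition near_entry : cmd := (
  rv <- 0 ;;
  racc <- $rH * ($rp / $rn % $rn =? $rp % $rn) ;;
  While ($rv <? $rn) near_step ;;
  Put nears $rp $racc ;;
  rp <- $rp + 1)%prog.

(** Layer 0 consists of the initial zeros, as [near 0] requires, so filling starts at address
    [n * n]. *)
Definition near_table : cmd := (
  rp <- $rn * $rn ;;
  While ($rp <? $rn * $rn * ($rn + 1)) near_entry)%prog.

Definition count_states : cmd := (
  rQ <- 1 ;;
  rv <- 0 ;;
  While ($rv <? $rn) (
    rQ <- $rQ * (1 + ($rq - 1) * cover[$rv]) ;;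
    rv <- $rv + 1))%prog.

(** Levels come from the last layer of [nears], at [t = n]; the vertex being decided is
    [rp / rQ - 1]. *)
Definition join_step : cmd := (
  rl <- cover[$rv] *
    emin ($rq - 1) (nears[$rn * ($rn * $rn) + ($rp / $rQ - 1) * $rn + $rv]) ;;
  rb <- 1 + ($rq - 1) * cover[$rv] ;;
  rok <- $rok * ($rx % $rb + $rl <? $rq) ;;
  rj <- $rj + $rw * emax ($rx % $rb) $rl ;;
  rx <- $rx / $rb ;;
  rw <- $rw * $rb ;;
  rv <- $rv + 1)%prog.

(** The entry for [i] and [s] is at address [i * Q + s], where [Q] is the number of states, so
    [rp - rQ] addresses the same state one row earlier. *)
Definition packing_entry : cmd := (
  rv <- 0 ;;
  rx <- $rp % $rQ ;;
  rw <- 1 ;;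
  rj <- 0 ;;
  rok <- 1 ;;
  While ($rv <? $rn) join_step ;;
  Put packings $rp (emax (packings[$rp - $rQ])
    ($rok * (packings[($rp / $rQ - 1) * $rQ + $rj] + 1))) ;;
  rp <- $rp + 1)%prog.

Definition packing_table : cmd := (
  rp <- $rQ ;;
  While ($rp <? $rQ * ($rn + 1)) packing_entry)%prog.

Definition program : cmd := (
  rq <- 3 + $rd % 2 ;;
  rH <- $rd / 2 + ($rq - 2) ;;
  near_table ;;
  count_states ;;
  packing_table ;;
  rn <- ($rk <? packings[$rn * $rQ] + 1))%prog.

#[local] Arguments upd A f i v j /.

(** * Correctness and step count of the program *)

Section Run.
Variables (n d k W : nat) (adj cov : nat -> nat).
Hypotheses (adj1 : forall p, adj p <= 1) (cov1 : forall c, cov c <= 1).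

Let q := 3 + d %% 2.
Let H := d %/ 2 + (q - 2).
Let Q := weight cov q n.

(** These bound all assigned values: [d + 4] covers [q], [H] and the small constants, the other two
    cover table addresses, encoded states and counters. *)
Hypotheses (d_lt : d + 4 < 2 ^ W) (n_lt : n * n * n.+1 < 2 ^ W).
Hypothesis Q_lt : Q * n.+1 < 2 ^ W.

Local Notation near' := (near n adj H).
Local Notation level' := (level n adj cov q H).
Local Notation digit' := (digit cov q).
Local Notation radix' := (radix cov q).
Local Notation weight' := (weight cov q).
Local Notation fits' := (fits n adj cov q H).
Local Notation join' := (join n adj cov q H).
Local Notation packing' := (packing n adj cov q H).

Definition near_at (p : nat) : nat :=
  near' (p %/ (n * n)) (p %/ n %% n) (p %% n).

Definition packing_at (p : nat) : nat := packing' (p %/ Q) (p %% Q).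

Definition params (s : store) : Prop :=
  [/\ var s rn = n, var s rk = k, var s rq = q, var s rH = H &
      arr s adjacency = adj /\ arr s cover = cov].

Lemma address_decode t u c : u < n -> c < n ->
  let p := t * (n * n) + u * n + c in
  [/\ p %/ (n * n) = t, p %/ n %% n = u & p %% n = c].
Proof.
move=> un cn p; have n0 : 0 < n by lia.
have ucn : u * n + c < n * n.
  apply: (@leq_trans (u.+1 * n)); last by rewrite leq_mul2r un orbT.
  by rewrite mulSn; lia.
have pE : p = (t * n + u) * n + c by rewrite /p; lia.
split.
- by rewrite /p -addnA divnMDl ?muln_gt0 ?n0 // divn_small // addn0.
- by rewrite pE divnMDl // (divn_small cn) addn0 modnMDl modn_small.
- by rewrite pE modnMDl modn_small.
Qed.

Lemma near_at_encode t u c : u < n -> c < n ->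
  near_at (t * (n * n) + u * n + c) = near' t u c.
Proof.
by move=> un cn; rewrite /near_at; case: (address_decode t un cn) => -> -> ->.
Qed.

Lemma packing_at_encode i s : s < Q -> packing_at (i * Q + s) = packing' i s.
Proof.
move=> sQ; have Q0 : 0 < Q by lia.
by rewrite /packing_at divnMDl // divn_small // addn0 modnMDl modn_small.
Qed.

Lemma H_lt : H < 2 ^ W.
Proof. rewrite /H /q; move: d_lt; lia. Qed.

Lemma n_le : n < 2 ^ W.
Proof. by apply: leq_ltn_trans n_lt; nia. Qed.

(** The last clause preserves the zeros that later serve as row 0 of the packing table. *)
Definition near_inv (p : nat) (s : store) : Prop :=
  [/\ params s, var s rp = p, (forall p', p' < p -> arr s nears p' = near_at p')
    & forall p', arr s packings p' = 0].

Lemma run_near_entry p s : n * n <= p -> p < n * n * n.+1 -> near_inv p s ->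
  runs W near_entry s (4 * n + 9) (near_inv p.+1).
Proof.
move=> le_p lt_p [[sn sk sq sH [sA sC]] sp sN sP].
have n0 : 0 < n by lia.
set u := p %/ n %% n; set c := p %% n; set t := p %/ (n * n) - 1.
have un : u < n by rewrite ltn_mod.
have cn : c < n by rewrite ltn_mod.
have pE : p = t.+1 * (n * n) + u * n + c.
  have t0 : 0 < p %/ (n * n) by rewrite divn_gt0 // muln_gt0 n0.
  rewrite /t subn1 prednK // {1}(divn_eq p n) {1}(divn_eq (p %/ n) n) -/u -/c.
  by rewrite divnMA; lia.
pose I v s := [/\ near_inv p s, var s rv = v & var s racc =
   maxn (H * (u == c)) (\max_(j < v) (adj (u * n + j) * (near' t j c - 1)))].
have acc_le v : maxn (H * (u == c))
    (\max_(j < v) (adj (u * n + j) * (near' t j c - 1))) <= H.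
  rewrite geq_max; apply/andP; split; first by case: eqP; rewrite ?muln1 ?muln0.
  apply/bigmax_leqP => j _; apply: (@leq_trans (1 * H)); last by rewrite mul1n.
  by rewrite leq_mul // (leq_trans (leq_subr _ _)) // near_leq.
have step v s1 : v < n -> I v s1 -> runs W near_step s1 3 (I v.+1).
  move=> vn [[[s1n s1k s1q s1H [s1A s1C]] s1p s1N s1P] s1v s1acc].
  have accE : eval s1 (emax $racc (adjacency[$rp / $rn % $rn * $rn + $rv] *
      (nears[($rp / ($rn * $rn) - 1) * ($rn * $rn) + $rv * $rn + $rp % $rn] - 1)))%prog
    = maxn (H * (u == c))
       (\max_(j < v.+1) (adj (u * n + j) * (near' t j c - 1))).
    rewrite eval_emax /= s1acc s1n s1p s1v s1A -/u -/c -/t big_ord_recr maxnA /=.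
    rewrite s1N ?near_at_encode //.
    (* The entry read is in layer [t] and [p] is in layer [t.+1], so it is already filled. *)
    rewrite pE mulSn ltn_add2r.
    apply: (@leq_trans (n * n + t * (n * n))); last exact: leq_addr.
    by rewrite addnC ltn_add2r ltn_pmul2r.
  apply: runs_assign_seq; rewrite accE; first exact: leq_ltn_trans H_lt.
  apply: runs_assign => /=; rewrite s1v ?addn1 //.
  exact: leq_ltn_trans vn n_le.
rewrite (_ : 4 * n + 9 = (4 * n + 5).+4); last by lia.
apply: runs_assign_seq => /=; first by rewrite expn_gt0.
apply: runs_assign_seq => /=.
  rewrite sH sp sn; apply: leq_ltn_trans H_lt.
  by case: eqP; rewrite ?muln1 ?muln0.
set s0 := set_var _ _ _.
have Is0 : I 0 s0.
  by split=> //=; rewrite sH sp sn big_ord0 maxn0.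
apply: (@runs_seq _ _ _ _ ((n - 0) * 4).+1 3 _ (I n)).
- apply: runs_while step _ Is0 => // j s' [[[sn' _ _ _ _] _ _ _] sv' _].
  by rewrite /= sn' sv'.
- move=> s1 [[[s1n s1k s1q s1H [s1A s1C]] s1p s1N s1P] s1v s1acc].
  apply: runs_put_seq => /=; first by rewrite s1acc; exact: leq_ltn_trans H_lt.
  apply: runs_assign => /=; rewrite s1p ?addn1; first exact: leq_ltn_trans n_lt.
  split=> //= p'; rewrite ltnS leq_eqVlt.
  case: (altP (p' =P p)) => [->|_] /=; last exact: s1N.
  by rewrite s1acc pE near_at_encode.
- lia.
Qed.


Lemma run_near_table s : params s -> (forall p, arr s nears p = 0) ->
  (forall p, arr s packings p = 0) ->
  runs W near_table s (n * n * n * (4 * n + 10) + 3) (near_inv (n * n * n.+1)).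
Proof.
move=> [sn sk sq sH [sA sC]] sN sP.
rewrite addnC; apply: runs_assign_seq => /=; rewrite sn.
  by apply: leq_ltn_trans n_lt; nia.
set s0 := set_var _ _ _.
have Is0 : near_inv (n * n) s0.
  split=> //= p lt_p; first by rewrite sN /near_at divn_small.
(* The lower bound joins the invariant because [run_near_entry] needs a preceding layer. *)
pose I p s := n * n <= p /\ near_inv p s.
have le_m : n * n <= n * n * n.+1 by nia.
have := @runs_while W ($rp <? $rn * $rn * ($rn + 1))%prog near_entry
  (4 * n + 9) (n * n * n.+1) I (n * n) s0.
case=> //.
- move=> j s' [_ [[sn' _ _ _ _] sp' _ _]].
  by rewrite /= sn' sp' addn1.
- move=> j s' lt_j [le_j Ij].
  apply: runs_weaken (run_near_entry le_j lt_j Ij) _ _ => // s'' ?.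
  by split=> //; apply: leqW.
- move=> t [s' [st le_t [_ Is']]]; exists t, s'; split=> //; nia.
Qed.

Lemma run_count_states p s : near_inv p s ->
  runs W count_states s (4 * n + 5)
    (fun s' => near_inv p s' /\ var s' rQ = Q).
Proof.
move=> [[sn sk sq sH [sA sC]] sp sN sP].
pose I v s := [/\ near_inv p s, var s rv = v & var s rQ = weight' v].
have le_Q v : v <= n -> weight' v < 2 ^ W.
  move=> vn; apply: leq_ltn_trans Q_lt.
  apply: (@leq_trans Q); last by rewrite leq_pmulr.
  by rewrite dvdn_leq ?weight_gt0 ?weight_dvd.
have W2 : 1 < 2 ^ W by move: d_lt; lia.
rewrite (_ : 4 * n + 5 = (4 * n + 1).+4); last by lia.
apply: runs_assign_seq => //; apply: runs_assign_seq => /=; first by lia.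
set s0 := set_var _ _ _.
have Is0 : I 0 s0 by split=> //=; rewrite /weight big_ord0.
have := @runs_while W ($rv <? $rn)%prog _ 3 n I 0 s0 _ _ (leq0n n) Is0.
move=> r; apply: runs_weaken (r _ _ _) _ _.
- by move=> j s' [[[sn' _ _ _ _] _ _ _] sv' _]; rewrite /= sn' sv'.
- move=> v s1 vn [[[s1n s1k s1q s1H [s1A s1C]] s1p s1N s1P] s1v s1Q].
  have wE : eval s1 ($rQ * (1 + ($rq - 1) * cover[$rv]))%prog = weight' v.+1.
    by rewrite /= s1Q s1q s1C s1v weightS.
  apply: runs_assign_seq; rewrite wE; first exact: le_Q.
  apply: runs_assign => /=; rewrite s1v ?addn1 //.
  exact: leq_ltn_trans vn n_le.
- by lia.
- by move=> s' [].
Qed.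

Definition packing_inv (p : nat) (s : store) : Prop :=
  [/\ params s, var s rp = p, var s rQ = Q,
      (forall u c, u < n -> c < n ->
         arr s nears (n * (n * n) + u * n + c) = near' n u c)
    & forall p', p' < p -> arr s packings p' = packing_at p'].

Lemma run_packing_entry p s : Q <= p -> p < Q * n.+1 -> packing_inv p s ->
  runs W packing_entry s (14 * n + 16) (packing_inv p.+1).
Proof.
move=> le_p lt_p [[sn sk sq sH [sA sC]] sp sQ sN sP].
have Q0 : 0 < Q by rewrite weight_gt0.
set i := p %/ Q - 1; set z := p %% Q.
have zQ : z < Q by rewrite ltn_mod.
have pE : p = i.+1 * Q + z.
  have i0 : 0 < p %/ Q by rewrite divn_gt0.
  by rewrite /i subn1 prednK // {1}(divn_eq p Q).
have i_n : i < n by move: lt_p; rewrite pE; nia.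
have ltW m : m <= Q -> m < 2 ^ W by move=> mQ; apply: leq_ltn_trans Q_lt; nia.
have lt4 m : m <= 4 -> m < 2 ^ W by move=> m4; move: d_lt; lia.
pose f j := maxn (digit' z j) (level' i j).
have f_lt j : f j < radix' j by rewrite gtn_max digit_lt level_lt.
pose I v s := [/\ packing_inv p s, var s rv = v, var s rx = z %/ weight' v,
  var s rw = weight' v &
  var s rj = \sum_(j < v) weight' j * f j /\
  var s rok = \big[andb/true]_(j < v) (digit' z j + level' i j < q) :> nat].
have le_Q v : v <= n -> weight' v <= Q.
  by move=> vn; rewrite dvdn_leq ?weight_dvd.
have radix_le v : radix' v <= 4.
  by rewrite /radix /q; case: (cov v) (cov1 v) => [|[|]] // _; lia.
have step v s1 : v < n -> I v s1 -> runs W join_step s1 13 (I v.+1).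
  move=> vn [[[s1n s1k s1q s1H [s1A s1C]] s1p s1Q s1N s1P] s1v s1x s1w [s1j s1ok]].
  have lE : eval s1 (cover[$rv] * emin ($rq - 1)
     (nears[$rn * ($rn * $rn) + ($rp / $rQ - 1) * $rn + $rv]))%prog = level' i v.
    by rewrite /= -minnE s1q s1n s1p s1Q s1v s1C -/i s1N.
  have bE : 1 + (var s1 rq - 1) * arr s1 cover (var s1 rv) = radix' v.
    by rewrite s1q s1C s1v.
  have okE : var s1 rok * (var s1 rx %% radix' v + level' i v < var s1 rq) =
      \big[andb/true]_(j < v.+1) (digit' z j + level' i j < q).
    by rewrite big_ord_recr /= s1ok s1x s1q mulnb.
  have jE : var s1 rj + var s1 rw * maxn (var s1 rx %% radix' v) (level' i v) =
      \sum_(j < v.+1) weight' j * f j.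
    by rewrite big_ord_recr /= s1j s1w s1x.
  have xE : var s1 rx %/ radix' v = z %/ weight' v.+1.
    by rewrite s1x weightS divnMA.
  have wE : var s1 rw * radix' v = weight' v.+1 by rewrite s1w weightS.
  apply: runs_assign_seq; rewrite lE.
    apply: lt4; rewrite ltnW // (leq_trans _ (radix_le v)) //.
    exact: level_lt.
  apply: runs_assign_seq => /=; rewrite bE; first exact: lt4.
  apply: runs_assign_seq => /=; rewrite okE.
    by apply: lt4; case: (\big[_/_]_(_ < _) _).
  apply: runs_assign_seq => /=; rewrite -maxnE jE.
    apply: ltW; apply: leq_trans (le_Q _ vn); apply: ltnW.
    exact: (encode_lt (f := f)).
  apply: runs_assign_seq => /=; rewrite xE.
    by apply: ltW; apply: leq_trans (leq_div _ _) _; apply: ltnW.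
  apply: runs_assign_seq => /=; rewrite wE; first by apply: ltW; apply: le_Q.
  apply: runs_assign => /=; rewrite s1v ?addn1 //.
  exact: leq_ltn_trans vn n_le.
rewrite (_ : 14 * n + 16 = (14 * n + 6).+4.+4.+2); last by lia.
do 5?[apply: runs_assign_seq => /=; first by [apply: lt4|
  apply: ltW; rewrite sp sQ ltnW]].
set s0 := set_var _ _ _.
have Is0 : I 0 s0.
  by split=> //=; rewrite ?big_ord0 ?sp ?sQ /weight ?big_ord0 ?divn1.
apply: (@runs_seq _ _ _ _ ((n - 0) * 14).+1 3 _ (I n)).
- apply: runs_while step _ Is0 => // j s' [[[sn' _ _ _ _] _ _ _ _] sv' _ _ _].
  by rewrite /= sn' sv'.
- move=> s1 [[[s1n s1k s1q s1H [s1A s1C]] s1p s1Q s1N s1P] s1v s1x s1w [s1j s1ok]].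
  have vE : eval s1 (emax (packings[$rp - $rQ])
      ($rok * (packings[($rp / $rQ - 1) * $rQ + $rj] + 1)))%prog = packing_at p.
    have joinE : \sum_(j < n) weight' j * f j = join' i z by [].
    have p1 : p - Q = i * Q + z by rewrite pE mulSn -addnA addKn.
    have fitsE : \big[andb/true]_(j < n) (digit' z j + level' i j < q) = fits' i z.
      by rewrite big_andE.
    have zi : join' i z < Q by apply: join_lt.
    rewrite eval_emax /= s1p s1Q s1j s1ok -/i joinE fitsE p1.
    (* Both entries read lie in row [i], while [p] is in row [i.+1]. *)
    have lt_pQ y : y < Q -> i * Q + y < p.
      move=> yQ; apply: (@leq_trans (i.+1 * Q)); last by rewrite pE leq_addr.
      by rewrite mulSn addnC ltn_add2r.
    rewrite !s1P ?lt_pQ // !packing_at_encode // addn1.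
    by rewrite [in RHS]pE packing_at_encode.
  have le_v : packing_at p <= n.
    rewrite [in X in X <= _]pE packing_at_encode //.
    exact: leq_trans (packing_leq _ _ _ _ _ _ _) _.
  apply: runs_put_seq; rewrite vE.
    by apply: leq_ltn_trans n_le.
  apply: runs_assign => /=; rewrite s1p ?addn1; first exact: leq_ltn_trans Q_lt.
  split=> //= p'; rewrite ltnS leq_eqVlt.
  by case: (altP (p' =P p)) => [->|_] //=; exact: s1P.
- lia.
Qed.

Lemma run_packing_table s : near_inv (n * n * n.+1) s -> var s rQ = Q ->
  runs W packing_table s (Q * n * (14 * n + 17) + 3) (packing_inv (Q * n.+1)).
Proof.
move=> [par sp sN sP] sQ.
rewrite addnC; apply: runs_assign_seq => /=; rewrite sQ.
  by apply: leq_ltn_trans Q_lt; rewrite leq_pmulr.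
set s0 := set_var _ _ _.
have Is0 : packing_inv Q s0.
  split=> //= [u c un cn|p lt_p].
    by rewrite sN ?near_at_encode //; nia.
  by rewrite sP /packing_at divn_small.
pose I p s := Q <= p /\ packing_inv p s.
have le_m : Q <= Q * n.+1 by rewrite leq_pmulr.
have := @runs_while W ($rp <? $rQ * ($rn + 1))%prog packing_entry
  (14 * n + 16) (Q * n.+1) I Q s0.
case=> //.
- move=> j s' [_ [[sn' _ _ _ _] sp' sQ' _ _]].
  by rewrite /= sn' sp' sQ' addn1.
- move=> j s' lt_j [le_j Ij].
  apply: runs_weaken (run_packing_entry le_j lt_j Ij) _ _ => // s'' ?.
  by split=> //; apply: leqW.
- move=> t [s' [st le_t [_ Is']]]; exists t, s'; split=> //; nia.
Qed.

Lemma run_program s : var s rn = n -> var s rd = d -> var s rk = k ->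
  arr s adjacency = adj -> arr s cover = cov ->
  (forall p, arr s nears p = 0) -> (forall p, arr s packings p = 0) ->
  runs W program s
    (n * n * n * (4 * n + 10) + (4 * n + 5) + Q * n * (14 * n + 17) + 20)
    (fun s' => var s' rn = (k <= packing' n 0)).
Proof.
move=> sn sd sk sA sC sN sP.
rewrite (_ : _ + 20 = (n * n * n * (4 * n + 10) + (4 * n + 5) +
  Q * n * (14 * n + 17) + 16).+4); last by lia.
apply: runs_assign_seq => /=; rewrite sd -/q.
  by move: d_lt; rewrite /q; lia.
apply: runs_assign_seq => /=; rewrite sd -/H; first exact: H_lt.
set s0 := set_var _ _ _.
have par0 : params s0 by [].
apply: (runs_seq (run_near_table par0 sN sP)
  (t2 := (4 * n + 5) + Q * n * (14 * n + 17) + 10)); last by lia.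
move=> s1 /run_count_states r1.
apply: (runs_seq r1 (t2 := Q * n * (14 * n + 17) + 5)); last by lia.
move=> s2 [inv2 s2Q].
apply: (runs_seq (run_packing_table inv2 s2Q) (t2 := 1)); last by lia.
move=> s3 [[s3n s3k _ _ _] _ s3Q _ s3P].
have Q0 : 0 < Q by rewrite weight_gt0.
have outE : eval s3 ($rk <? packings[$rn * $rQ] + 1)%prog = (k <= packing' n 0).
  rewrite /= s3n s3k s3Q -[n * Q]addn0 s3P ?packing_at_encode // ?addn1 ?ltnS //.
  by rewrite addn0 mulnC ltn_pmul2l.
apply: runs_assign; rewrite outE //.
by apply: leq_ltn_trans (leq_b1 _) _; move: d_lt; lia.
Qed.

End Run.

End Program.

(** * Running time *)

Section Input.
Variables (n : nat) (e : rel 'I_n) (d k : nat) (C : {set 'I_n}).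

Lemma input_adj (u v : 'I_n) : arr (input e d k C) 0 (u * n + v) = e u v.
Proof.
rewrite /=; congr nat_of_bool; apply/existsP/idP => [[i /existsP[j]]|uv].
  have n_gt0 : 0 < n by apply: leq_ltn_trans (ltn_ord u).
  case/andP => /eqP eq_uv; suff [-> ->] : u = i /\ v = j by [].
  have := congr1 (modn^~ n) eq_uv; rewrite !modnMDl !modn_small // => /ord_inj <-.
  have := congr1 (divn^~ n) eq_uv.
  by rewrite !divnMDl // !divn_small // !addn0 => /ord_inj <-.
by exists u; apply/existsP; exists v; rewrite eqxx.
Qed.

Lemma input_cov (c : 'I_n) : arr (input e d k C) 1 c = (c \in C).
Proof.
rewrite /=; congr nat_of_bool; apply/existsP/idP => [[i]|cC].
  by case/andP => /eqP/ord_inj->.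
by exists c; rewrite eqxx.
Qed.

(** The dummy digits have radix 1, which leaves one factor [q] per vertex of the cover. *)
Lemma weight_input q : 0 < q -> weight (arr (input e d k C) 1) q n = q ^ #|C|.
Proof.
move=> q_gt0; rewrite -prod_nat_const [RHS]big_mkcond /weight.
apply: eq_bigr => c _; rewrite /radix input_cov.
by case: ifP; rewrite ?muln1 ?muln0 // add1n subn1 prednK.
Qed.

Lemma input_bounded W : 0 < W -> n < 2 ^ W -> d < 2 ^ W -> k < 2 ^ W ->
  bounded W (input e d k C).
Proof.
move=> W_gt0 nW dW kW; have W2 : 1 < 2 ^ W by rewrite -{1}(expn0 2) ltn_exp2l.
split=> [[|[|[|x]]]|[|[|a]] p] //=; rewrite ?expn_gt0 //;
  exact: leq_ltn_trans (leq_b1 _) W2.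
Qed.

End Input.

Lemma input_size_bounds n d k (S := input_size n d k) :
  [/\ n <= S, 2 < S, n < 2 ^ S, d < 2 ^ S & k < 2 ^ S].
Proof.
have bl m : m < 2 ^ bitlen m by exact: ltn_bitlen.
have b0 m : 0 < bitlen m by [].
have le m : bitlen m <= S -> m < 2 ^ S.
  by move=> mS; apply: leq_trans (bl m) _; rewrite leq_exp2l.
have := b0 n; have := b0 d; have := b0 k.
by split; try apply: le; rewrite /S /input_size; nia.
Qed.

Theorem theorem4 :
  exists (c : cmd) (a m : nat),
  forall (n : nat) (e : rel 'I_n) (d k : nat) (C : {set 'I_n}),
    symmetric e -> irreflexive e -> 2 < d -> vertex_cover e C ->
    exists (t : nat) (s : store),
      [/\ exec c (input e d k C) t s,
          output s = nat_of_bool (has_scattered_set e d k),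
          ~~ odd d -> t <= a * input_size n d k ^ m * 3 ^ #|C|
        & odd d -> t <= a * input_size n d k ^ m * 4 ^ #|C|].
Proof.
(* There are at most [74 * S ^ 4 * q ^ #|C|] steps, each of cost at most [4 * S * ccost program],
   and [296 = 4 * 74]. *)
exists program, (296 * ccost program), 5 => n e d k C e_sym _ d_gt2 C_cover.
set S := input_size n d k; set q := 3 + d %% 2.
have [nS S_gt2 nS2 dS kS] := input_size_bounds n d k.
rewrite -/S in nS S_gt2 nS2 dS kS.
set adj := arr (input e d k C) 0; set cov := arr (input e d k C) 1.
have adj1 p : adj p <= 1 by exact: leq_b1.
have cov1 p : cov p <= 1 by exact: leq_b1.
have QE : weight cov q n = q ^ #|C| by apply: weight_input.
(* As [#|C| <= n <= S], the number of states is at most [4 ^ S], that is two factors [2 ^ S]. A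
   third absorbs [n.+1] and the fourth makes the bound strict. *)
pose W := 4 * S.
have WE : 2 ^ W = 2 ^ S * 2 ^ S * 2 ^ S * 2 ^ S.
  by rewrite -!expnD; congr (2 ^ _); rewrite /W; lia.
have S8 : 8 <= 2 ^ S by rewrite (@leq_exp2l 2 3).
have ltW m : m < 2 ^ S * 2 ^ S * 2 ^ S -> m < 2 ^ W.
  by move=> lt_m; rewrite WE; nia.
have lt1 m : m < 2 ^ S -> m < 2 ^ W by move=> lt_m; apply: ltW; nia.
have d_lt : d + 4 < 2 ^ W by apply: ltW; nia.
have n_lt : n * n * n.+1 < 2 ^ W.
  apply: ltW; apply: (@leq_ltn_trans (n * n * 2 ^ S)).
    by rewrite leq_mul2l nS2 orbT.
  by rewrite ltn_pmul2r ?expn_gt0 // ltn_mul.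
have Q_lt : weight cov q n * n.+1 < 2 ^ W.
  rewrite QE WE; apply: (@leq_ltn_trans (2 ^ S * 2 ^ S * 2 ^ S)); last by nia.
  apply: leq_mul; last by [].
  apply: (@leq_trans (4 ^ S)); last by rewrite -expnMn.
  apply: (@leq_trans (4 ^ #|C|)); first by
    case: #|C| => // m; rewrite leq_exp2r // /q; lia.
  by rewrite leq_exp2l // (leq_trans (max_card _)) // card_ord.
have W_gt0 : 0 < W by rewrite /W; lia.
have [t [s [st le_t out]]] := run_program adj1 cov1 d_lt n_lt Q_lt
  (k := k) (s := input e d k C) erefl erefl erefl erefl erefl
  (fun=> erefl) (fun=> erefl).
have bs := input_bounded e C W_gt0 (lt1 _ nS2) (lt1 _ dS) (lt1 _ kS).
have [_ [t' ex le_t']] := exec_of_steps W_gt0 bs st.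
suff le : t' <= 296 * ccost program * S ^ 5 * q ^ #|C|.
  exists t', s; split=> //.
  - have adjE : forall u v : 'I_n, adj (u * n + v) = e u v by exact: input_adj.
    have covE : forall c : 'I_n, cov c = (c \in C) by exact: input_cov.
    by rewrite (has_scattered_set_packing e_sym d_gt2 C_cover adjE covE cov1).
  - by move=> d_even; move: le; rewrite /q modn2 (negbTE d_even).
  - by move=> d_odd; move: le; rewrite /q modn2 d_odd.
apply: leq_trans le_t' _; rewrite QE in le_t.
have Q_gt0 : 0 < q ^ #|C| by rewrite expn_gt0.
(* Here 74 is [14 + 9 + 31 + 20]: the first table, the count of states, the second table and the
   additive constant. *)
have {}le_t : t <= 74 * S ^ 4 * q ^ #|C|.
  apply: leq_trans le_t _; move: (q ^ _) Q_gt0 => z z_gt0.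
  have lin b c : 0 < c -> b * n + c <= (b + c) * S by move=> c_gt0; nia.
  have S_le : S <= S ^ 4 by rewrite -{1}(expn1 S) leq_pexp2l //; lia.
  have S2_le : S ^ 2 <= S ^ 4 by rewrite leq_pexp2l //; lia.
  have S4_le : S ^ 4 <= S ^ 4 * z by rewrite leq_pmulr.
  have cubic : n * n * n * (4 * n + 10) <= 14 * S ^ 4.
    rewrite (expnS S 3) mulnA mulnC leq_mul ?lin //.
    by rewrite !expnS expn0 muln1 mulnA !leq_mul.
  have quadratic : z * n * (14 * n + 17) <= 31 * (S ^ 4 * z).
    apply: (@leq_trans (z * S * (31 * S))); first by rewrite !leq_mul ?lin.
    rewrite (_ : z * S * (31 * S) = 31 * (S ^ 2 * z)); last by lia.
    by rewrite leq_mul2l leq_mul2r S2_le !orbT.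
  by have := lin 4 5; lia.
apply: (@leq_trans (74 * S ^ 4 * q ^ #|C| * (W * ccost program))).
  by rewrite leq_mul2r le_t orbT.
rewrite /W (expnS S 4); move: (S ^ 4) (q ^ _) (ccost _) => x y z; lia.
Qed.
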